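(* Suppose that $f:\mathbb{R}^n\to\mathbb{R}$ is differentiable with $L_f$-Lipschitz continuous gradient ($L_f>0$), that $g:\mathbb{R}^n\to\overline{\mathbb{R}}$ is proper, lower semicontinuous and convex, and that $\operatorname{argmin}\varphi\neq\emptyset$ where $\varphi=f+g$. Let $\gamma\in(0,1/L_f)$ and consider the iterates generated by the PANOC-lite algorithm (described in the context) with this $\gamma$. Let $x^\star$ be a strong local minimizer of $\varphi$ such that $\nabla^2f$ exists and is strictly continuous around $x^\star$, and $g$ is strictly twice epi-differentiable at $x^\star$ for $-\nabla f(x^\star)$ with generalized quadratic second-order epi-derivative. Suppose that $(\hat x^k)_{k\in\mathbb{N}}$ converges to $x^\star$ and that the directions $(\bar d^k)_{k\in\mathbb{N}}$ satisfy the Dennis–Moré condition $$\lim_{k\to\infty}\frac{\|R^{\rm nor}_\gamma(\bar x^k)+\mathrm{J}R^{\rm nor}_\gamma(\bar x^\star)\,\bar d^k\|}{\|\bar d^k\|}=0,\qquad \bar x^\star:=x^\star-\gamma\nabla f(x^\star).$$ Then $$\lim_{k\to\infty}\frac{\|\bar x^k+\bar d^k-\bar x^\star\|}{\|\bar x^k-\bar x^\star\|}=0,$$ and in particular $\tau_k=1$ is accepted for all sufficiently large $k$ and $(\hat x^k)_{k\in\mathbb{N}}$ converges superlinearly to $x^\star$, i.e. $\lim_{k\to\infty}\|\hat x^{k+1}-x^\star\|/\|\hat x^k-x^\star\|=0$.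
   Context: $\overline{\mathbb{R}}=\mathbb{R}\cup\{+\infty\}$, $\mathbb{N}=\{0,1,2,\dots\}$, $\|\cdot\|$ is the Euclidean norm. $\operatorname{prox}_{\gamma g}(x)=\operatorname{argmin}_u\{g(u)+\frac1{2\gamma}\|u-x\|^2\}$, $T_\gamma(x)=\operatorname{prox}_{\gamma g}(x-\gamma\nabla f(x))$. Natural residual: $R^{\rm nat}_\gamma(x)=\gamma^{-1}(x-T_\gamma(x))$. Normal residual: $R^{\rm nor}_\gamma(z)=\nabla f(\operatorname{prox}_{\gamma g}(z))+\gamma^{-1}(z-\operatorname{prox}_{\gamma g}(z))$. $\mathrm{J}F(x)$ is the Jacobian of $F$ at $x$ (under the stated assumptions $R^{\rm nor}_\gamma$ is strictly differentiable at $\bar x^\star$). A point $x^\star$ is a strong local minimizer of $\varphi$ if there exist $\mu>0$ and a neighborhood $U$ of $x^\star$ such that $\varphi(x)\ge\varphi(x^\star)+\frac\mu2\|x-x^\star\|^2$ for all $x\in U$. Strictly continuous means locally Lipschitz continuous. A limit of quotients presupposes that the quotients are well defined (nonzero denominators) for all sufficiently large $k$. For $x$ with $g(x)$ finite, $v\in\mathbb{R}^n$, $\tau>0$, let $\Delta^2_\tau g(x|v)(w)=\frac{g(x+\tau w)-g(x)-\tau\langle v,w\rangle}{\tau^2/2}$. For $\bar v\in\partial g(\bar x)$ (convex subdifferential), $g$ is strictly twice epi-differentiable at $\bar x$ for $\bar v$ if the functions $\Delta^2_\tau g(x|v)$ epi-converge to a (proper) function as $\tau\downarrow0$ and $(x,v)\to(\bar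 x,\bar v)$ with $v\in\partial g(x)$ and $g(x)\to g(\bar x)$; the limit is the second-order epi-derivative. It is generalized quadratic if it has the form $w\mapsto\langle w,Mw\rangle+\delta_S(w)$ for some $M\in\mathbb{R}^{n\times n}$ and linear subspace $S\subseteq\mathbb{R}^n$, where $\delta_S$ is $0$ on $S$ and $+\infty$ elsewhere. PANOC-lite algorithm. Parameters: $x^0\in\mathbb{R}^n$, $\gamma\in(0,2/L_f)$, $\beta\in(0,1)$, $\sigma\in\bigl(0,\gamma\frac{2-\gamma L_f}{2}\bigr)$. Initialize $\hat x^0=\operatorname{prox}_{\gamma g}(x^0)$. For $k=0,1,2,\dots$: set $\bar x^k=\hat x^k-\gamma\nabla f(\hat x^k)$ and $R^{\rm nat}_\gamma(\hat x^k)=\gamma^{-1}(\hat x^k-\operatorname{prox}_{\gamma g}(\bar x^k))$; select an arbitrary direction $\bar d^k\in\mathbb{R}^n$ and let $x^{k+1}=\bar x^k+\tau_k\bar d^k$, $\hat x^{k+1}=\operatorname{prox}_{\gamma g}(x^{k+1})$, where $\tau_k$ is the largest element of $\{\beta^i\mid i\in\mathbb{N}\}$ such that the linesearch condition $\varphi(\hat x^{k+1})-\varphi(\hat x^k)\le-\sigma\|R^{\rm nat}_\gamma(\hat x^k)\|^2$ holds. ''Generated by the algorithm'' means infinite sequences of iterates satisfying these relations for all $k\in\mathbb{N}$. *)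

(* Defs.v *)
(* Vectors of R^n are row vectors 'rV[R]_n. *)
From HB Require Import structures.
From mathcomp Require Export all_boot all_order all_algebra.
From mathcomp Require Export all_classical all_reals all_analysis.
Export Order.TTheory GRing.Theory Num.Theory.
Export numFieldNormedType.Exports.

Set Implicit Arguments.
Unset Strict Implicit.
Unset Printing Implicit Defensive.

Local Open Scope classical_set_scope.
Local Open Scope ring_scope.

Section Euclidean.
Context {R : realType} {n : nat}.
Implicit Types u v : 'rV[R]_n.

Definition dot u v : R := \sum_i u 0 i * v 0 i.

(* The library norm `|u| on 'rV[R]_n is the sup norm; both norms induce the
   topology used for limits and neighborhoods below. *)
Definition enorm u : R := Num.sqrt (dot u u).

End Euclidean.

Section ExtendedRealFunctions.
Context {R : realType} {n : nat}.
Notation V := 'rV[R]_n.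
Implicit Types (h : V -> \bar R) (x v : V).

(* Both [proper_fun] and convexity are meant for functions into R U {+oo};
   [proper_fun] excludes the value -oo. *)
Definition proper_fun h : Prop :=
  (forall x, h x != -oo%E) /\ (exists x, (h x < +oo)%E).

Definition convex_fun h : Prop := forall x y (t : R), 0 < t < 1 ->
  (h (t *: x + (1 - t) *: y)%R <= t%:E * h x + (1 - t)%:E * h y)%E.

Definition argmin h : set V := [set u | forall y, (h u <= h y)%E].

Definition subdiff h x : set V :=
  [set v | h x \is a fin_num /\ forall y, (h x + (dot v (y - x)%R)%:E <= h y)%E].

Definition strong_local_min h x : Prop :=
  exists2 mu : R, 0 < mu &
    \forall y \near x, (h x + (mu / 2 * enorm (y - x)%R ^+ 2)%:E <= h y)%E.

(* For proper lsc convex h and gamma > 0 the argmin is a singleton. *)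
Definition prox (gamma : R) h x : V :=
  xget 0 (argmin (fun u => (h u + ((2 * gamma)^-1 * enorm (u - x)%R ^+ 2)%:E)%E)).

End ExtendedRealFunctions.

Section EpiConvergence.

(* Painleve-Kuratowski inner and outer limits of sets along a filter F. *)
Definition inner_lim {T : Type} {Y : topologicalType}
    (F : set_system T) (C : T -> set Y) : set Y :=
  [set y | forall U, nbhs y U -> \forall t \near F, C t `&` U !=set0].

Definition outer_lim {T : Type} {Y : topologicalType}
    (F : set_system T) (C : T -> set Y) : set Y :=
  [set y | forall U, nbhs y U -> ~ \forall t \near F, C t `&` U = set0].

Context {R : realType} {n : nat}.
Notation V := 'rV[R]_n.

Definition epigraph (h : V -> \bar R) : set (V * R) :=
  [set p | (h p.1 <= p.2%:E)%E].

Definition epi_converges {T : Type} (F : set_system T)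
    (h : T -> V -> \bar R) (h0 : V -> \bar R) : Prop :=
  inner_lim F (fun t => epigraph (h t)) = epigraph h0 /\
  outer_lim F (fun t => epigraph (h t)) = epigraph h0.

Definition diff_quot2 (g : V -> \bar R) (tau : R) (x v w : V) : \bar R :=
  ((g (x + tau *: w)%R - g x - (tau * dot v w)%:E) * ((tau ^+ 2 / 2)^-1)%:E)%E.

(* tau decreases to 0 and (x, v) --> (x0, v0) with v in the subdifferential of
   g at x and g x --> g x0; the last component of q carries the value g x. *)
Definition attentive (g : V -> \bar R) (x0 v0 : V) : set_system (R * V * V) :=
  fst @ within [set q : R * V * V * \bar R |
                 [/\ 0 < q.1.1.1, subdiff g q.1.1.2 q.1.2 & q.2 = g q.1.1.2]]
               (nbhs (0, x0, v0, g x0)).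

(* g is strictly twice epi-differentiable at x for v, with second-order
   epi-derivative h. *)
Definition strict_epi_deriv2 (g : V -> \bar R) (x v : V) (h : V -> \bar R) :
    Prop :=
  [/\ subdiff g x v, proper_fun h &
      epi_converges (attentive g x v)
        (fun p => diff_quot2 g p.1.1 p.1.2 p.2) h].

Definition generalized_quadratic (h : V -> \bar R) : Prop :=
  exists (M : 'M[R]_n) (S : {vspace V}), forall w,
    h w = if w \in S then (dot w (w *m M^T))%:E else +oo%E.

End EpiConvergence.

Section Smooth.
Context {R : realType} {n : nat}.
Notation V := 'rV[R]_n.

(* Meaningful where f is differentiable. *)
Definition grad (f : V -> R) (x : V) : V := \row_i 'D_(delta_mx 0 i) f x.

(* By symmetry of second derivatives the transposition convention of
   [jacobian] (which acts on row vectors from the right) is immaterial here;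
   equivalence of norms makes the library matrix norm adequate for local
   Lipschitz continuity. *)
Definition hessian (f : V -> R) (x : V) : 'M[R]_n := jacobian (grad f) x.

Definition strictly_C2_around (f : V -> R) (x : V) : Prop :=
  \forall y \near x,
    differentiable (grad f) y /\ lipschitz_on (hessian f) (nbhs (y, y)).

Definition gradient_lipschitz (L : R) (f : V -> R) : Prop :=
  forall x y, enorm (grad f x - grad f y) <= L * enorm (x - y).

End Smooth.

Section Algorithm.
Context {R : realType} {n : nat}.
Notation V := 'rV[R]_n.
Variables (f : V -> R) (g : V -> \bar R).

Definition phi (x : V) : \bar R := ((f x)%:E + g x)%E.

Definition fb_map (gamma : R) (x : V) : V :=
  prox gamma g (x - gamma *: grad f x).

Definition Rnat (gamma : R) (x : V) : V := gamma^-1 *: (x - fb_map gamma x).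

Definition Rnor (gamma : R) (z : V) : V :=
  grad f (prox gamma g z) + gamma^-1 *: (z - prox gamma g z).

Definition linesearch (gamma sigma : R) (xhat xbar d : V) (t : R) : Prop :=
  (phi (prox gamma g (xbar + t *: d)%R) - phi xhat
     <= (- (sigma * enorm (Rnat gamma xhat) ^+ 2))%:E)%E.

Definition panoc_lite (gamma beta sigma : R)
    (x xhat xbar d : nat -> V) (tau : nat -> R) : Prop :=
  xhat 0%N = prox gamma g (x 0%N) /\
  forall k : nat,
    [/\ xbar k = xhat k - gamma *: grad f (xhat k),
        x k.+1 = xbar k + tau k *: d k,
        xhat k.+1 = prox gamma g (x k.+1),
        (exists i : nat, tau k = beta ^+ i) /\
          linesearch gamma sigma (xhat k) (xbar k) (d k) (tau k)
      & forall j : nat,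
          linesearch gamma sigma (xhat k) (xbar k) (d k) (beta ^+ j) ->
          beta ^+ j <= tau k].

End Algorithm.

(* Limit of quotients equal to 0; the denominators are required to be
   eventually nonzero because division by zero is total in the library. *)
Definition quot_cvg0 {R : realType} (a b : nat -> R) : Prop :=
  (\forall k \near \oo, b k != 0) /\ (a k / b k @[k --> \oo] --> (0 : R)).

(* Main.v *)
Require Import Defs.
From mathcomp Require Import ring lra.

Set Implicit Arguments.
Unset Strict Implicit.
Unset Printing Implicit Defensive.

Local Open Scope classical_set_scope.
Local Open Scope ring_scope.

(** Write P for the proximal map, F for the normal residual, xs for the
    minimizer, vs = - grad f xs and zs = xs + gamma vs, so that P zs = xs and
    F zs = 0.

    The heart of the matter is that F is differentiable at zs with an
    invertible Jacobian.  The quotient xi = (P (zs + tau w) - xs) / tau is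
    itself a proximal point: it minimizes
    Delta_tau(xi) + |xi - w|^2 / gamma, where Delta_tau is the second-order
    difference quotient of g at xs for vs ([prox_quot_min]).  These quotients
    are bounded because P is nonexpansive, and epi-convergence forces every
    cluster point, as tau tends to 0, to minimize h(xi) + |xi - w|^2 / gamma
    for the epi-derivative h ([epi_limit_minimizer]).  As h is quadratic on a
    subspace, the limit problem has a single solution w D, linear in w
    ([galerkin_matrix], [quadratic_stationary]); a compactness argument then
    shows that P is Frechet differentiable at zs with derivative D
    ([prox_differentiable]).

    A strong local minimizer satisfies
    mu |xi|^2 <= <H xi, xi> + h xi, with H the Hessian of f at xs
    ([second_order_growth]).  If w is in the kernel of the Jacobian of F,
    then xi = w D satisfies H xi = (xi - w) / gamma, while stationarity gives
    h xi = <w - xi, xi> / gamma; the growth inequality leaves xi = 0, whence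
    w = 0 ([Rnor_regular]).

    Differentiability and invertibility turn the Dennis-More condition into
    |xbar k + d k - zs| = o(|xbar k - zs|) ([dennis_more_step]); this also
    excludes xbar k = zs, which would force d k = 0.

    The unit step passes the linesearch because phi (P z) - phi xs is
    O(|z - zs|^2) ([phi_prox_upper]), hence o(|xhat k - xs|^2) for
    z = xbar k + d k, whereas the sufficient decrease of a forward-backward
    step ([forward_backward_descent]) together with strong minimality leaves
    a margin of order |xhat k - xs|^2.  Superlinear convergence of xhat then
    follows from nonexpansiveness of P. *)

(** * Euclidean inner product and norm *)

Section EuclideanLemmas.
Context {R : realType} {n : nat}.
Implicit Types u v w : 'rV[R]_n.

Lemma dotC u v : dot u v = dot v u.
Proof. by apply: eq_bigr => i _; rewrite mulrC. Qed.

Lemma dotDl u v w : dot (u + v) w = dot u w + dot v w.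
Proof. by rewrite -big_split; apply: eq_bigr => i _; rewrite !mxE mulrDl. Qed.

Lemma dotZl a u w : dot (a *: u) w = a * dot u w.
Proof. by rewrite mulr_sumr; apply: eq_bigr => i _; rewrite !mxE mulrA. Qed.

Lemma dotNl u w : dot (- u) w = - dot u w.
Proof. by rewrite -scaleN1r dotZl mulN1r. Qed.

Lemma dotBl u v w : dot (u - v) w = dot u w - dot v w.
Proof. by rewrite dotDl dotNl. Qed.

Lemma dotDr u v w : dot w (u + v) = dot w u + dot w v.
Proof. by rewrite dotC dotDl !(dotC w). Qed.

Lemma dotZr a u w : dot w (a *: u) = a * dot w u.
Proof. by rewrite dotC dotZl dotC. Qed.

Lemma dotNr u w : dot w (- u) = - dot w u.
Proof. by rewrite dotC dotNl dotC. Qed.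

Lemma dotBr u v w : dot w (u - v) = dot w u - dot w v.
Proof. by rewrite dotDr dotNr. Qed.

Lemma dot0l u : dot 0 u = 0.
Proof. by rewrite -(scale0r 0) dotZl mul0r. Qed.

Lemma dot0r u : dot u 0 = 0.
Proof. by rewrite dotC dot0l. Qed.

Definition dotE := (dotDl, dotDr, dotNl, dotNr, dotZl, dotZr).

Lemma dot_mulmx u v : (u *m v^T) 0 0 = dot u v.
Proof. by rewrite mxE; apply: eq_bigr => i _; rewrite !mxE. Qed.

Lemma dot_ge0 u : 0 <= dot u u.
Proof. by apply: sumr_ge0 => i _; rewrite -expr2 sqr_ge0. Qed.

Lemma dot_eq0 u : dot u u = 0 -> u = 0.
Proof.
move=> u0; apply/rowP => i; rewrite mxE; apply/eqP; rewrite -sqrf_eq0 expr2.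
have /psumr_eq0P/(_ u0 i isT) -> // : forall j, true -> 0 <= u 0 j * u 0 j.
by move=> j _; rewrite -expr2 sqr_ge0.
Qed.

Lemma enorm_ge0 u : 0 <= enorm u.
Proof. exact: sqrtr_ge0. Qed.

Lemma sqr_enorm u : enorm u ^+ 2 = dot u u.
Proof. by rewrite sqr_sqrtr// dot_ge0. Qed.

Lemma enorm0 : enorm (0 : 'rV[R]_n) = 0.
Proof. by rewrite /enorm dot0l sqrtr0. Qed.

Lemma enorm_eq0 u : enorm u = 0 -> u = 0.
Proof. by move=> u0; apply: dot_eq0; rewrite -sqr_enorm u0 expr0n. Qed.

Lemma enormZ a u : enorm (a *: u) = `|a| * enorm u.
Proof.
by rewrite /enorm dotZl dotZr mulrA -expr2 sqrtrM ?sqr_ge0// sqrtr_sqr.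
Qed.

Lemma enormN u : enorm (- u) = enorm u.
Proof. by rewrite -scaleN1r enormZ normrN1 mul1r. Qed.

Lemma enormBC u v : enorm (u - v) = enorm (v - u).
Proof. by rewrite -enormN opprB. Qed.

Lemma dot_le_enorm u v : dot u v <= enorm u * enorm v.
Proof.
have [v0|v0] := eqVneq (enorm v) 0.
  by rewrite v0 (enorm_eq0 v0) dot0r mulr0.
have vgt0 : 0 < enorm v by rewrite lt_def v0 enorm_ge0.
have [uv0|uv0] := leP (dot u v) 0.
  by rewrite (le_trans uv0)// mulr_ge0// enorm_ge0.
rewrite -ler_sqr ?nnegrE ?mulr_ge0 ?enorm_ge0 ?(ltW uv0)// exprMn !sqr_enorm.
have := dot_ge0 (dot v v *: u - dot u v *: v).
rewrite !dotE (dotC v u).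
have : 0 < dot v v by rewrite -sqr_enorm exprn_gt0.
set a := dot u u; set b := dot u v; set c := dot v v => c0 H.
have : 0 <= c * (a * c - b ^+ 2) by lra.
by rewrite pmulr_rge0// subr_ge0.
Qed.

Lemma enormD u v : enorm (u + v) <= enorm u + enorm v.
Proof.
rewrite -ler_sqr ?nnegrE ?addr_ge0 ?enorm_ge0// sqr_enorm !dotE (dotC v u).
rewrite sqrrD !sqr_enorm; have := dot_le_enorm u v; lra.
Qed.

Lemma enormB u v : enorm (u - v) <= enorm u + enorm v.
Proof. by rewrite -(enormN v) enormD. Qed.

Lemma enorm_triangle w u v : enorm (u - v) <= enorm (u - w) + enorm (w - v).
Proof. by rewrite (le_trans _ (enormD _ _))// addrA subrK. Qed.

Lemma norm_le_enorm u : `|u| <= enorm u.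
Proof.
rewrite [leLHS]/Num.Def.normr/= mx_normrE.
apply: bigmax_le; first exact: enorm_ge0.
move=> [i j] _ /=; rewrite ord1 -ler_sqr ?nnegrE ?enorm_ge0// sqr_enorm.
rewrite real_normK ?num_real// /dot (bigD1 j)//= -expr2 lerDl.
by apply: sumr_ge0 => k _; rewrite -expr2 sqr_ge0.
Qed.

Lemma coord_le_norm u i : `|u 0 i| <= `|u|.
Proof.
rewrite [leRHS]/Num.Def.normr/= mx_normrE.
exact: (le_bigmax _ (fun ij : 'I_1 * 'I_n => `|u ij.1 ij.2|) (0, i)).
Qed.

Lemma enorm_le_norm u : enorm u <= n%:R * `|u|.
Proof.
rewrite -ler_sqr ?nnegrE ?enorm_ge0 ?mulr_ge0// sqr_enorm exprMn.
apply: (@le_trans _ _ (n%:R * `|u| ^+ 2)).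
  rewrite mulr_natl -[X in _ *+ X](card_ord n) -sumr_const.
  apply: ler_sum => i _; rewrite -expr2 -real_normK ?num_real//.
  by rewrite ler_sqr ?nnegrE ?coord_le_norm.
rewrite ler_wpM2r ?sqr_ge0// expr2 -natrM ler_nat.
by case: (n) => // m; rewrite leq_pmulr.
Qed.

End EuclideanLemmas.

Lemma mulmx_enorm_bound {R : realType} n m (A : 'M[R]_(n, m)) :
  exists2 C, 0 < C & forall u, enorm (u *m A) <= C * enorm u.
Proof.
pose B := \sum_i \sum_j `|A i j|.
have B0 : 0 <= B by apply: sumr_ge0 => i _; apply: sumr_ge0.
exists (1 + m%:R * B); first by rewrite ltr_pwDl// mulr_ge0.
move=> u.
have uA : `|u *m A| <= B * enorm u.
  rewrite [leLHS]/Num.Def.normr/= mx_normrE.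
  apply: bigmax_le; first by rewrite mulr_ge0// enorm_ge0.
  move=> [i j] _ /=; rewrite ord1 mxE (le_trans (ler_norm_sum _ _ _))//.
  rewrite mulr_suml; apply: ler_sum => k _; rewrite normrM mulrC.
  apply: ler_pM => //; last first.
    by rewrite (le_trans (coord_le_norm _ _))// norm_le_enorm.
  by rewrite (bigD1 j)//= lerDl sumr_ge0.
rewrite (le_trans (enorm_le_norm _))// mulrDl mul1r -mulrA ler_wpDl ?enorm_ge0//.
by rewrite ler_wpM2l.
Qed.

Section EuclideanTopology.
Context {R : realType} {n : nat}.
Notation V := 'rV[R]_n.

(** Since |u| <= enorm u <= n |u| for the sup norm |u|, topological statements
    can be handled by Euclidean epsilon estimates. *)
Lemma nbhs_enormP (a : V) (P : V -> Prop) :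
  (\forall u \near a, P u) <->
  exists2 e : R, 0 < e & forall u, enorm (u - a) < e -> P u.
Proof.
split=> [/nbhs_normP[e /= e0 eP]|[e e0 eP]].
  exists e => // u ue; apply: eP => /=.
  by rewrite distrC (le_lt_trans (norm_le_enorm _)).
apply/nbhs_normP; exists (e / n.+1%:R); first by rewrite /= divr_gt0.
move=> u /=; rewrite distrC => ue; apply: eP.
rewrite (le_lt_trans (enorm_le_norm _))//.
rewrite ltr_pdivlMr// in ue; rewrite (le_lt_trans _ ue)// mulrC.
by rewrite ler_wpM2l// ler_nat.
Qed.

Lemma enorm_continuous : continuous (enorm : V -> R).
Proof.
move=> a; apply/(cvgrPdist_lt (FF := nbhs_filter a)) => e e0.
apply/nbhs_enormP; exists e => // u ue.
apply: le_lt_trans ue; rewrite ler_norml; apply/andP; split.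
  by have := enormD (u - a) a; rewrite subrK; lra.
by have := enormD (a - u) u; rewrite subrK enormBC; lra.
Qed.

Lemma dot_cvg T (F : set_system T) (FF : Filter F) (a b : T -> V) (a0 b0 : V) :
  a @ F --> a0 -> b @ F --> b0 -> dot (a t) (b t) @[t --> F] --> dot a0 b0.
Proof.
move=> aF bF; apply: (cvg_big (op := +%R)) => [|i _].
  exact: add_continuous.
apply: (@cvgM _ _ F FF (fun t => a t 0 i) (fun t => b t 0 i)).
  exact: (cvg_comp _ _ aF (@coord_continuous _ _ _ 0 i a0)).
exact: (cvg_comp _ _ bF (@coord_continuous _ _ _ 0 i b0)).
Qed.

Lemma enorm_cvg0 T (F : set_system T) (FF : Filter F) (a : T -> V) (a0 : V) :
  a @ F --> a0 -> enorm (a t - a0) @[t --> F] --> (0 : R).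
Proof.
move=> aF; rewrite -(enorm0 (R := R) (n := n)) -(subrr a0).
apply: continuous_cvg; first exact: enorm_continuous.
by apply: cvgB => //; apply: cvg_cst.
Qed.

End EuclideanTopology.

(** Ultrafilters replace the extraction of subsequences: along a single one,
    all quantities with values in compact sets converge simultaneously. *)
Lemma ultra_cvg T (X : topologicalType) (F : set_system T) (f : T -> X)
    (K : set X) :
  UltraFilter F -> compact K -> (\forall t \near F, K (f t)) ->
  exists2 p, K p & f @ F --> p.
Proof.
move=> FU cK FK; have [p [Kp clp]] := cK (f @ F) _ FK; exists p => // N pN.
have [//|FnN] := in_ultra_setVsetC (f @^-1` N) FU.
by have [? []] := clp (~` N) N FnN pN.
Qed.

Lemma enorm_ball_compact {R : realType} n (c : R) :
  compact [set u : 'rV[R]_n | enorm u <= c].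
Proof.
apply: bounded_closed_compact.
  exists c; split; first exact: num_real.
  move=> M cM u /= uc.
  by rewrite (le_trans (norm_le_enorm _))// (le_trans uc)// ltW.
rewrite -[X in closed X]/(enorm @^-1` [set x | x <= c]).
apply: preimage_closed; last exact: closed_le.
by move=> u _; apply: enorm_continuous.
Qed.

(** * Differential calculus in the Euclidean norm *)

(** The epsilon form of Frechet differentiability: this lemma and the two that
    follow move between it and the little-o form. *)
Lemma norm_diff {R : realType} (V W : normedModType R) (F : V -> W) (a : V)
    (df : {linear V -> W}) :
  continuous df ->
  (forall e : R, 0 < e ->
    \forall u \near (0 : V), `|F (a + u) - F a - df u| <= e * `|u|) ->
  differentiable F a /\ 'd F a = df :> (V -> W).
Proof.
move=> cdf dF; have oF : F \o shift a = cst (F a) + df +o_0 id.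
  apply/eqaddoP => e e0; apply: filterS (dF e e0) => u.
  by rewrite /= !fctE /= (addrC u a) opprD addrA.
have dFE := diff_unique cdf oF; split => //.
by apply/diff_locallyP; rewrite dFE.
Qed.

Section Frechet.
Context {R : realType} {n : nat}.
Notation V := 'rV[R]_n.

Lemma diff_enorm (F : V -> V) (a : V) : differentiable F a ->
  forall e : R, 0 < e -> exists2 r, 0 < r & forall u, enorm u < r ->
    enorm (F (a + u) - F a - 'd F a u) <= e * enorm u.
Proof.
move=> /diff_locallyP[_ /eqaddoP dF] e e0.
have en0 : 0 < e / n.+1%:R by rewrite divr_gt0.
have /nbhs_enormP[r r0 Hr] := dF _ en0; exists r => // u ur.
have := Hr u; rewrite subr0 => /(_ ur) /=.
rewrite fctE/= !fctE /= (addrC u a) opprD addrA => H.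
rewrite (le_trans (enorm_le_norm _))//.
rewrite (le_trans (ler_wpM2l _ H))//.
rewrite mulrA (mulrC e) mulrA; apply: ler_pM => //; last exact: norm_le_enorm.
  by rewrite mulr_ge0 ?(ltW e0)// divr_ge0.
by rewrite ler_piMl ?(ltW e0)// ler_pdivrMr// mul1r ler_nat.
Qed.

Lemma enorm_diff (F : V -> V) (a : V) (A : 'M[R]_n) :
  (forall e : R, 0 < e -> exists2 r, 0 < r & forall u, enorm u < r ->
    enorm (F (a + u) - F a - u *m A) <= e * enorm u) ->
  differentiable F a /\ forall u, 'd F a u = u *m A.
Proof.
move=> FA.
have cA : continuous (mulmxr A : V -> V).
  have [C C0 AC] := mulmx_enorm_bound A.
  move=> u; apply/(cvgrPdist_lt (FF := nbhs_filter u)) => e e0.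
  apply/nbhs_enormP; exists (e / C); first by rewrite divr_gt0.
  move=> w; rewrite ltr_pdivlMr// => wu.
  rewrite distrC (le_lt_trans (norm_le_enorm _))// /= -mulmxBl.
  by rewrite (le_lt_trans (AC _))// mulrC.
have oA (e : R) : 0 < e ->
    \forall u \near (0 : V), `|F (a + u) - F a - mulmxr A u| <= e * `|u|.
  move=> e0; apply/nbhs_enormP.
  have en0 : 0 < e / n.+1%:R by rewrite divr_gt0.
  have [r r0 Hr] := FA _ en0; exists r => // u; rewrite subr0 => /Hr H.
  rewrite (le_trans (norm_le_enorm _))// (le_trans H)//.
  rewrite -mulrA ler_wpM2l ?(ltW e0)// ler_pdivrMl//.
  by rewrite (le_trans (enorm_le_norm _))// ler_wpM2r// ler_nat.
by have [dF ->] := norm_diff cA oA.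
Qed.

End Frechet.

Section Smooth.
Context {R : realType} {n : nat}.
Notation V := 'rV[R]_n.
Variable f : V -> R.
Hypothesis f_diff : forall y, differentiable f y.

Lemma diff_grad (y u : V) : 'd f y u = dot (grad f y) u.
Proof.
rewrite [in LHS](row_sum_delta u) linear_sum; apply: eq_bigr => i _.
by rewrite linearZ mxE deriveE// mulrC.
Qed.

Lemma is_derive_line (x u : V) (t : R) :
  is_derive t 1 (fun s => f (x + s *: u)) (dot (grad f (x + t *: u)) u).
Proof.
have E : (fun h : R => h^-1 *: (f (x + (h *: 1 + t) *: u) - f (x + t *: u))) =
    (fun h : R => h^-1 *: (f (h *: u + (x + t *: u)) - f (x + t *: u))).
  by apply/funext => h; rewrite scalerDl -scalerA scale1r addrCA.
have := @diff_derivable _ _ _ f (x + t *: u) u (f_diff _) => Df.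
split; first by rewrite /derivable /= E.
rewrite /derive /= E -[LHS]/('D_u f (x + t *: u)).
by rewrite deriveE// diff_grad.
Qed.

(** Apply the mean value theorem to f (x + t u) minus the quadratic
    interpolant, whose slope dominates.  Asking for a one-sided bound only
    lets the same lemma give the descent lemma (K = L |u|^2) and the
    second-order Taylor estimate (K = <H u, u> + e |u|^2). *)
Lemma slope_upper_bound (x u : V) (K : R) :
  (forall t : R, 0 <= t <= 1 ->
    dot (grad f (x + t *: u) - grad f x) u <= t * K) ->
  f (x + u) <= f x + dot (grad f x) u + K / 2.
Proof.
move=> HK; set c := dot (grad f x) u.
pose F (t : R) := f (x + t *: u) - (t * c + K / 2 * t ^+ 2).
pose dF (t : R) := dot (grad f (x + t *: u)) u - (c + K * t).
have dFP (t : R) : is_derive t (1 : R) F (dF t).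
  have dq : is_derive t (1 : R) (fun s : R => s * c + K / 2 * s ^+ 2) (c + K * t).
    apply: is_derive_eq; rewrite /GRing.scale /=.
    by field.
  exact: is_deriveB (is_derive_line x u t) dq.
have [] := @MVT_segment R F dF 0 1 ler01 (fun t _ => dFP t).
  by apply: derivable_within_continuous => t _; have [] := dFP t.
move=> t; rewrite in_itv/= => t01; rewrite subr0 mulr1 => FE.
have : dF t <= 0.
  by rewrite /dF; have := HK t t01; rewrite dotBl -/c; lra.
by rewrite -FE /F scale1r scale0r addr0; lra.
Qed.

Lemma descent_lemma (L : R) (x u : V) : gradient_lipschitz L f ->
  f (x + u) <= f x + dot (grad f x) u + L / 2 * enorm u ^+ 2.
Proof.
move=> fL; rewrite mulrAC; apply: slope_upper_bound => t /andP[t0 _].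
rewrite (le_trans (dot_le_enorm _ _))//.
have := fL (x + t *: u) x.
rewrite [x + _ - x]addrAC subrr add0r enormZ ger0_norm// => H.
by rewrite (le_trans (ler_wpM2r (enorm_ge0 _) H))//; lra.
Qed.

(** Only the upper half of the Taylor expansion is stated: it will be compared
    with a lower bound coming from minimality. *)
Lemma taylor2_upper (x : V) (e : R) : differentiable (grad f) x -> 0 < e ->
  exists2 r, 0 < r & forall u, enorm u < r ->
    f (x + u) <= f x + dot (grad f x) u
      + (dot ('d (grad f) x u) u + e * enorm u ^+ 2) / 2.
Proof.
move=> dg e0; have [r r0 Hr] := diff_enorm dg e0; exists r => // u ur.
apply: slope_upper_bound => t /andP[t0 t1].
have tur : enorm (t *: u) < r.
  by rewrite enormZ ger0_norm// (le_lt_trans _ ur)// ler_piMl// enorm_ge0.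
have := Hr _ tur; rewrite linearZ enormZ ger0_norm//.
set w := _ - _ - _ => wu.
have -> : grad f (x + t *: u) - grad f x = w + t *: 'd (grad f) x u.
  by rewrite /w subrK.
rewrite dotDl dotZl.
have := le_trans (dot_le_enorm w u) (ler_wpM2r (enorm_ge0 u) wu); lra.
Qed.

End Smooth.

(** * The proximal map of a convex function *)

Lemma le0_small_mult {R : realType} (a b : R) :
  (forall t : R, 0 < t < 1 -> a <= t * b) -> a <= 0.
Proof.
move=> H; apply/ler_addgt0Pr => e e0; rewrite add0r.
have bp : 0 < `|b| + e + 1 by rewrite ltr_pwDr// addr_ge0// ltW.
have t0 : 0 < e / (`|b| + e + 1) by rewrite divr_gt0.
have t1 : e / (`|b| + e + 1) < 1.
  by rewrite ltr_pdivrMr// mul1r; have := normr_ge0 b; lra.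
rewrite (le_trans (H _ (introT andP (conj t0 t1))))//.
rewrite mulrAC ler_pdivrMr// ler_wpM2l ?(ltW e0)//.
by rewrite (le_trans (ler_norm b))//; lra.
Qed.

Section Prox.
Context {R : realType} {n : nat}.
Notation V := 'rV[R]_n.
Variables (g : V -> \bar R) (gamma : R) (x0 v0 : V).
Hypotheses (gamma_gt0 : 0 < gamma) (g_proper : proper_fun g)
  (g_lsc : lower_semicontinuous g) (g_convex : convex_fun g)
  (v0P : subdiff g x0 v0).

Let obj (z u : V) : \bar R :=
  (g u + ((2 * gamma)^-1 * enorm (u - z)%R ^+ 2)%:E)%E.

Lemma subdiff_mono x1 v1 x2 v2 : subdiff g x1 v1 -> subdiff g x2 v2 ->
  0 <= dot (v1 - v2) (x1 - x2).
Proof.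
move=> [f1 /(_ x2) h1] [f2 /(_ x1)]; move: h1.
rewrite -(fineK f1) -(fineK f2) -!EFinD !lee_fin dotBl.
rewrite -(opprB x1) dotNr; lra.
Qed.

(** The subgradient v0 bounds g below by an affine function, and completing
    the square turns that into a quadratic bound on the proximal objective. *)
Lemma prox_obj_lower z : exists c : R, forall u,
  ((c + (2 * gamma)^-1 * enorm (u - (z - gamma *: v0)) ^+ 2)%:E <= obj z u)%E.
Proof.
case: v0P => f0 H0.
exists (fine (g x0) + dot v0 (z - x0) - gamma / 2 * dot v0 v0) => u.
rewrite /obj; apply: le_trans (leeD (H0 u) (lexx _)).
rewrite -[X in (_ <= X + _ + _)%E](fineK f0) -!EFinD lee_fin !sqr_enorm.
rewrite opprB addrA (addrAC u) !dotE !(dotC v0).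
set a := dot _ _; set b := dot _ _; set c := dot _ _; set d := dot _ _.
set e := dot u z; set h := dot z u; set k := dot z z; set l := dot _ _.
rewrite le_eqVlt; apply/orP; left; apply/eqP; field.
by rewrite gt_eqF.
Qed.

(** A minimizing sequence is bounded by the previous lemma; lower
    semicontinuity passes to its limit along an ultrafilter. *)
Lemma prox_obj_attained z : argmin (obj z) !=set0.
Proof.
have [c cP] := prox_obj_lower z; set a := z - gamma *: v0 in cP.
have g2 : 0 < (2 * gamma)^-1 by rewrite invr_gt0 mulr_gt0.
pose l := ereal_inf (range (obj z)).
have cl : (c%:E <= l)%E.
  apply: le_ereal_inf_tmp => _ [u _ <-]; apply: le_trans (cP u).
  by rewrite lee_fin lerDl mulr_ge0 ?(ltW g2)// sqr_ge0.
have lu u : (l <= obj z u)%E by apply: ereal_inf_lbound; exists u.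
have lfin : l \is a fin_num.
  rewrite fin_numE; apply/andP; split.
    by apply/eqP => lE; rewrite lE leeNy_eq in cl.
  apply/eqP => lE; have := lu x0; rewrite lE leye_eq /obj.
  by case: v0P => /fineK <- _; rewrite -EFinD.
set r := fine l; have lE : l = r%:E by rewrite fineK.
have seqP (k : nat) : exists u, (obj z u < (r + k.+1%:R^-1)%:E)%E.
  have k0 : 0 < (k.+1%:R^-1 : R) by rewrite invr_gt0.
  have [_ [u _ <-]] := lb_ereal_inf_adherent k0 lfin.
  by rewrite -/l lE -EFinD => H; exists u.
have [u uP] := choice seqP.
have [U [UU sU]] := @ultraFilterLemma _ (\oo : set_system nat) _.
pose q (w : V) := (2 * gamma)^-1 * enorm (w - z) ^+ 2.
have K2 k : (2 * gamma)^-1 * enorm (u k - a) ^+ 2 <= r + 1 - c.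
  have := ltW (le_lt_trans (cP _) (uP k)); rewrite lee_fin => H.
  have k1 : (k.+1%:R^-1 : R) <= 1 by rewrite invf_le1// ler1n.
  by rewrite lerBrDl (le_trans H)// lerD2l.
pose C := enorm a + (1 + (2 * gamma) * (r + 1 - c)).
have uC : \forall k \near U, [set w : V | enorm w <= C] (u k).
  apply: nearW => k; rewrite /C /=.
  have := K2 k; rewrite mulrC ler_pdivrMr ?mulr_gt0// mulrC.
  set m := enorm _; set M := _ * _ => mM.
  have : m <= 1 + M.
    have := sqr_ge0 (m - 1); have := enorm_ge0 (u k - a).
    rewrite -/m; move: mM; rewrite sqrrB1 => *; nra.
  by move=> ?; have := enormD (u k - a) a; rewrite subrK -/m; lra.
have [p _ up] := ultra_cvg UU (@enorm_ball_compact R n C) uC.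
have qp : q (u k) @[k --> U] --> q p.
  rewrite /q; apply: cvgMr; under eq_fun do rewrite sqr_enorm.
  by rewrite sqr_enorm; apply: dot_cvg; apply: cvgB => //; apply: cvg_cst.
have rp : r + k.+1%:R^-1 @[k --> U] --> r.
  rewrite -[X in _ --> X]addr0; apply: cvgD; first exact: cvg_cst.
  by move=> A /cvg_harmonic HA; apply: sU.
have gp_le (b : R) : (b%:E < g p)%E -> b + q p <= r.
  move=> /g_lsc[W pW WP]; apply: (@ler_cvg_to _ U _ _ (fun k => b + q (u k))
    (fun k => r + k.+1%:R^-1)) => //.
    by apply: cvgD => //; apply: cvg_cst.
  have UW : \forall k \near U, W (u k) by apply: up.
  near=> k; rewrite -lee_fin; apply: le_trans (ltW (uP k)).
  rewrite EFinD; apply: leeD => //; apply/ltW/WP.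
  by near: k.
exists p => y; apply: le_trans (lu y); rewrite lE /obj -/(q p).
move: gp_le; case: (g p) (g_proper.1 p) => [s||//] _ H.
- rewrite -EFinD lee_fin; apply/ler_addgt0Pr => e e0.
  by have := H (s - e); rewrite lte_fin gtrBl => /(_ e0); lra.
- have /H : ((r - q p + 1)%R%:E < +oo)%E by rewrite ltry.
  by move=> rq; exfalso; lra.
Unshelve. all: by end_near.
Qed.

Lemma prox_argmin z : argmin (obj z) (prox gamma g z).
Proof. exact: xgetPex (prox_obj_attained z). Qed.

Lemma prox_fin_num z : g (prox gamma g z) \is a fin_num.
Proof.
have := prox_argmin z x0; rewrite /obj -(fineK v0P.1) -EFinD.
by have := g_proper.1 (prox gamma g z); case: (g _).
Qed.

(** Optimality of p = prox z against p + t (y - p), with t tending to 0: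
    convexity makes the change of g at most linear in t, while the quadratic
    term contributes its derivative plus O(t^2). *)
Lemma prox_subdiff z :
  subdiff g (prox gamma g z) (gamma^-1 *: (z - prox gamma g z)).
Proof.
split=> [|y]; first exact: prox_fin_num.
have pmin := prox_argmin z; have pfin := prox_fin_num z.
set p := prox gamma g z in pmin pfin *.
have [gyE|gyE] := eqVneq (g y) +oo%E; first by rewrite gyE leey.
have yfin : g y \is a fin_num.
  by rewrite fin_numE gyE andbT; apply: g_proper.1.
rewrite -(fineK pfin) -(fineK yfin) -EFinD lee_fin.
rewrite -subr_le0; apply: (@le0_small_mult _ _
  ((2 * gamma)^-1 * dot (y - p) (y - p))) => t t01.
have /andP[t0 t1] := t01.
have := le_trans (pmin (t *: y + (1 - t) *: p))
  (leeD (g_convex y p t01) (lexx _)).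
rewrite /obj -(fineK pfin) -(fineK yfin) -!EFinM -!EFinD lee_fin.
have -> : t *: y + (1 - t) *: p - z = (p - z) + t *: (y - p).
  by rewrite scalerBl scale1r scalerBr [RHS]addrC !addrA; congr (_ - _);
    rewrite addrAC.
rewrite !sqr_enorm -(opprB p z) scalerN dotNl dotZl.
rewrite !(dotDl (p - z)) !(dotDr (p - z)) !dotZl !dotZr (dotC (y - p) (p - z)).
set P := fine (g p); set Y := fine (g y).
set a := dot _ _; set b := dot _ _; set c := dot _ _ => H.
rewrite -(ler_pM2l t0).
have -> : t * (t * ((2 * gamma)^-1 * c)) = (2 * gamma)^-1 * (t * (t * c)) by ring.
have E : gamma^-1 = 2 * (2 * gamma)^-1 by field; rewrite gt_eqF.
rewrite E; move: H; set k := (2 * gamma)^-1 => /=; lra.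
Qed.

Lemma prox_firm z1 z2 :
  dot (prox gamma g z1 - prox gamma g z2) (prox gamma g z1 - prox gamma g z2)
    <= dot (z1 - z2) (prox gamma g z1 - prox gamma g z2).
Proof.
have := subdiff_mono (prox_subdiff z1) (prox_subdiff z2).
rewrite -scalerBr dotZl pmulr_rge0 ?invr_gt0// => H.
rewrite -subr_ge0 -dotBl; congr (0 <= dot _ _) : H.
by rewrite !opprB addrACA [RHS]addrACA; congr (_ + _); rewrite addrC.
Qed.

Lemma prox_nonexpansive z1 z2 :
  enorm (prox gamma g z1 - prox gamma g z2) <= enorm (z1 - z2).
Proof.
have := le_trans (prox_firm z1 z2) (dot_le_enorm _ _); rewrite -sqr_enorm expr2.
have [->|p0] := eqVneq (enorm (prox gamma g z1 - prox gamma g z2)) 0.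
  by rewrite enorm_ge0.
by rewrite ler_pM2r// lt_def p0 enorm_ge0.
Qed.

(** The proximal map is the resolvent of the subdifferential: monotonicity
    leaves at most one y with (z - y) / gamma in the subdifferential at y. *)
Lemma prox_resolvent y v : subdiff g y v -> prox gamma g (y + gamma *: v) = y.
Proof.
move=> yv; have := subdiff_mono (prox_subdiff (y + gamma *: v)) yv.
set p := prox _ _ _ => H; apply/eqP; rewrite -subr_eq0; apply/eqP/dot_eq0.
apply/eqP; rewrite eq_le dot_ge0 andbT.
have E : gamma^-1 *: (y + gamma *: v - p) - v = - (gamma^-1 *: (p - y)).
  rewrite -scalerN opprB addrAC scalerDr scalerA mulVf ?gt_eqF// scale1r.
  by rewrite addrK.
by move: H; rewrite E dotNl dotZl oppr_ge0 pmulr_rle0// invr_gt0.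
Qed.

End Prox.

(** * Quadratic minimization on a subspace *)

Section QuadraticMinimization.
Context {R : realType} {n : nat}.
Notation V := 'rV[R]_n.
Implicit Types (a b w : V) (S : {vspace V}) (M N : 'M[R]_n).

Lemma dot_adj M a b : dot a (b *m M^T) = dot (a *m M) b.
Proof. by rewrite -!dot_mulmx trmx_mul trmxK mulmxA. Qed.

(** In a basis E of S the equation a N e^T = k w e^T for e in S has the
    invertible Gram matrix E N E^T. *)
Lemma galerkin_matrix S N (k : R) :
  (forall a, a \in S -> dot (a *m N) a = 0 -> a = 0) ->
  exists D : 'M[R]_n, forall w, w *m D \in S /\
    forall e, e \in S -> dot (w *m D *m N) e = k * dot w e.
Proof.
move=> Npos; pose X := vbasis S; pose E := \matrix_i X`_i : 'M[R]_(\dim S, n).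
have mulE c : c *m E = \sum_i c 0 i *: X`_i.
  by rewrite mulmx_sum_row; apply: eq_bigr => i _; rewrite rowK.
have ES (c : 'rV_(\dim S)) : c *m E \in S.
  rewrite mulE; apply: rpred_sum => i _; apply: rpredZ.
  by apply: vbasis_mem; apply: mem_nth; rewrite size_tuple.
have SE e : e \in S -> exists c, e = c *m E.
  move=> eS; exists (\row_i coord X i e).
  rewrite mulE {1}(coord_vbasis eS); apply: eq_bigr => i _.
  by rewrite mxE.
have E_inj (c : 'rV_(\dim S)) : c *m E = 0 -> c = 0.
  rewrite mulE => c0; apply/rowP => i; rewrite [RHS]mxE.
  by have /freeP/(_ (fun i => c 0 i) c0 i) := basis_free (vbasisP S).
have G_unit : E *m N *m E^T \in unitmx.
  rewrite -row_free_unit; apply: inj_row_free => c c0.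
  apply: E_inj; apply: (Npos _ (ES c)).
  by rewrite -dot_mulmx trmx_mul !mulmxA -(mulmxA c) -(mulmxA c) c0 mul0mx mxE.
exists (k *: (E^T *m invmx (E *m N *m E^T) *m E)) => w; split.
  by rewrite -scalemxAr !mulmxA scalemxAl ES.
move=> e /SE[c ->]; rewrite -!dot_mulmx trmx_mul.
rewrite -scalemxAr -!scalemxAl mxE; congr (_ * _).
rewrite !mulmxA -(mulmxA _ E N) -(mulmxA _ (E *m N) E^T).
by rewrite mulmxKV.
Qed.

Lemma linear_part_eq0 (b c : R) : (forall s, 0 <= s * b + s ^+ 2 * c) -> b = 0.
Proof.
move=> H; apply/eqP; rewrite eq_le; apply/andP; split.
  apply: (@le0_small_mult _ _ c) => t /andP[t0 _].
  by rewrite -(ler_pM2l t0); have := H (- t); lra.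
rewrite -oppr_le0; apply: (@le0_small_mult _ _ c) => t /andP[t0 _].
by rewrite -(ler_pM2l t0); have := H t; lra.
Qed.

(** First-order condition along the lines x + s e. The matrix is the Hessian,
    up to a factor 2, of the objective: only the symmetric part of M enters. *)
Lemma quadratic_stationary S M (k : R) (x w : V) : x \in S ->
  (forall e, e \in S -> dot x (x *m M^T) + k * enorm (x - w) ^+ 2 <=
     dot e (e *m M^T) + k * enorm (e - w) ^+ 2) ->
  forall e, e \in S ->
    dot (x *m (2^-1 *: (M + M^T) + k%:M)) e = k * dot w e.
Proof.
move=> xS xmin e eS; apply/eqP; rewrite -subr_eq0; apply/eqP.
apply: (@linear_part_eq0 _ ((dot (e *m M) e + k * dot e e) / 2)) => s.
have seS : x + s *: e \in S by rewrite rpredD// rpredZ.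
have := xmin _ seS; rewrite !sqr_enorm !dot_adj.
rewrite mulmxDr mul_mx_scalar -scalemxAr mulmxDr mulmxDl -scalemxAl !dotE.
have -> : dot (x *m M^T) e = dot (e *m M) x by rewrite dotC dot_adj.
by rewrite !(dotC e x) !(dotC e w) !(dotC w x); lra.
Qed.

End QuadraticMinimization.

(** * Second-order epi-limits at the base point *)

Lemma cvg_to_pair T (X Y : topologicalType) (F : set_system T) (FF : Filter F)
    (a : T -> X) (b : T -> Y) (a0 : X) (b0 : Y) :
  a @ F --> a0 -> b @ F --> b0 -> (fun t => (a t, b t)) @ F --> (a0, b0).
Proof. exact: cvg_pair. Qed.

Section EpiLimit.
Context {R : realType} {n : nat}.
Notation V := 'rV[R]_n.
Variables (g : V -> \bar R) (xb vb : V) (h : V -> \bar R).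
Hypotheses (g_proper : proper_fun g) (gh : strict_epi_deriv2 g xb vb h).

Let xb_sub : subdiff g xb vb. Proof. by case: gh. Qed.

Let xb_fin : g xb \is a fin_num. Proof. by case: xb_sub. Qed.

(** Upper bounds on the difference quotient are all that epigraphs see, and in
    this form they involve no extended-real subtraction. *)
Lemma diff_quot2_le tau w c : 0 < tau ->
  (diff_quot2 g tau xb vb w <= c%:E)%E =
  (g (xb + tau *: w)%R <=
     (fine (g xb) + tau * dot vb w + tau ^+ 2 / 2 * c)%:E)%E.
Proof.
move=> t0; have s0 : 0 < tau ^+ 2 / 2 by rewrite divr_gt0// exprn_gt0.
rewrite /diff_quot2 -(fineK xb_fin).
case: (g (xb + _)) (g_proper.1 (xb + tau *: w)) => [r||//] _.
  rewrite -!EFinD -EFinM !lee_fin ler_pdivrMr//=.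
  by apply/idP/idP; lra.
by rewrite !addye// mulyr gtr0_sg ?invr_gt0// mul1e !leye_eq.
Qed.

(** Freezing (x, v) at the base point and letting tau alone tend to 0 is one
    admissible way to approach the limit, so inner and outer epi-limits along
    it are controlled by those along the attentive filter. *)
Lemma attentive_base T (F : set_system T) (FF : Filter F) (tau : T -> R) :
  (\forall t \near F, 0 < tau t) -> tau @ F --> 0 ->
  (fun t => (tau t, xb, vb)) @ F --> attentive g xb vb.
Proof.
move=> tau_gt0 tau0 A /=; rewrite /attentive /fmap /= /within /= => nA.
have c : (fun t => (tau t, xb, vb, g xb)) @ F --> (0 : R, xb, vb, g xb).
  by do 3 (apply: cvg_to_pair; last exact: cvg_cst).
by have := c _ nA; apply: filterS2 tau_gt0 => t t0 /=; apply.
Qed.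

(** The limit inequality of epi-convergence, from the outer limit of the
    epigraphs. *)
Lemma epi_limit_lower T (F : set_system T) (FF : ProperFilter F) (tau : T -> R)
    (xi : T -> V) (al : T -> R) (xi0 : V) (al0 : R) :
  (\forall t \near F, 0 < tau t) -> tau @ F --> 0 ->
  xi @ F --> xi0 -> al @ F --> al0 ->
  (\forall t \near F, (diff_quot2 g (tau t) xb vb (xi t) <= (al t)%:E)%E) ->
  (h xi0 <= al0%:E)%E.
Proof.
move=> tau_gt0 tau0 xi_cvg al_cvg dq; case: gh => _ _ [_ out].
suff : epigraph h (xi0, al0) by [].
rewrite -out => A nA AE.
have xa : (fun t => (xi t, al t)) @ F --> (xi0, al0) by apply: cvg_to_pair.
have [t [[]]] := filter_ex (filterI (filterI dq (xa _ nA))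
  (attentive_base FF tau_gt0 tau0 AE)).
move=> dqt At /= A0.
suff : (epigraph (diff_quot2 g (tau t) xb vb) `&` A) (xi t, al t) by rewrite A0.
by split.
Qed.

(** The recovery property of epi-convergence, from the inner limit of the
    epigraphs: points close to xi0 almost attain the limit value. *)
Lemma epi_limit_recovery T (F : set_system T) (FF : Filter F)
    (tau : T -> R) (A : set V) (xi0 : V) (c e : R) :
  (\forall t \near F, 0 < tau t) -> tau @ F --> 0 ->
  (h xi0 <= c%:E)%E -> nbhs xi0 A -> 0 < e ->
  \forall t \near F, exists2 w, A w &
    (diff_quot2 g (tau t) xb vb w <= (c + e)%:E)%E.
Proof.
move=> tau_gt0 tau0 hc nA e0; case: gh => _ _ [inn _].
have : epigraph h (xi0, c) by [].
rewrite -inn => /(_ (A `*` [set r | r < c + e])) H.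
have : nbhs (xi0, c) (A `*` [set r | r < c + e]).
  exists (A, [set r | r < c + e]) => //; split => //=.
  by apply: lt_nbhsl; rewrite ltrDl.
move=> /H nU.
have : \forall t \near F, epigraph (diff_quot2 g (tau t) xb vb) `&`
    (A `*` [set r | r < c + e]) !=set0 by exact: (attentive_base FF tau_gt0 tau0 nU).
apply: filterS => t [[w r] [/= wr [/= Aw rc]]]; exists w => //.
by rewrite (le_trans wr)// lee_fin ltW.
Qed.

(** This is the subgradient inequality of vb at xb. *)
Lemma diff_quot2_ge0 tau w c : 0 < tau ->
  (diff_quot2 g tau xb vb w <= c%:E)%E -> 0 <= c.
Proof.
move=> t0; rewrite diff_quot2_le// => gw.
have := le_trans (xb_sub.2 _) gw.
rewrite (addrAC xb) subrr add0r -[X in (X + _)%E](fineK xb_fin) -EFinD.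
by rewrite lee_fin dotZr lerDl pmulr_rge0// divr_gt0// exprn_gt0.
Qed.

Lemma epi_limit_ge0 w c : (h w <= c%:E)%E -> 0 <= c.
Proof.
move=> hc; apply/ler_addgt0Pr => e e0.
have near0 : \forall t \near (0 : R)^'+, 0 < t by exact: nbhs_right_gt.
have cvg0 : id @ (0 : R)^'+ --> (0 : R) by exact: cvg_within.
have [t [t0 [w' _]]] := filter_ex (filterI near0
  (epi_limit_recovery _ near0 cvg0 hc filterT e0)).
exact: diff_quot2_ge0.
Qed.

End EpiLimit.

(** * Differentiability of the proximal map *)

Section ProxDerivative.
Context {R : realType} {n : nat}.
Notation V := 'rV[R]_n.
Variables (g : V -> \bar R) (xb vb : V) (h : V -> \bar R) (gamma : R).
Hypotheses (gamma_gt0 : 0 < gamma) (g_proper : proper_fun g)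
  (g_lsc : lower_semicontinuous g) (g_convex : convex_fun g)
  (gh : strict_epi_deriv2 g xb vb h).

Let xb_sub : subdiff g xb vb. Proof. by case: gh. Qed.

Let prox_min z := prox_argmin gamma_gt0 g_proper g_lsc xb_sub z.

Let prox_fin z := prox_fin_num gamma_gt0 g_proper g_lsc xb_sub z.

(** Minimality survives in the limit: any competitor e of the limit problem is
    approached by competitors e' of the problems at t, at almost no extra
    cost. *)
Lemma epi_limit_minimizer (T : topologicalType) (F : set_system T)
    (FF : ProperFilter F) (tau : T -> R) (w xi : T -> V) (al : T -> R) (w0 xi0 : V) (al0 k : R) :
  0 <= k -> (\forall t \near F, 0 < tau t) -> tau @ F --> 0 ->
  w @ F --> w0 -> xi @ F --> xi0 -> al @ F --> al0 ->
  (\forall t \near F, forall e c,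
     (diff_quot2 g (tau t) xb vb e <= c%:E)%E ->
     al t + k * enorm (xi t - w t) ^+ 2 <= c + k * enorm (e - w t) ^+ 2) ->
  forall e c, (h e <= c%:E)%E ->
    al0 + k * enorm (xi0 - w0) ^+ 2 <= c + k * enorm (e - w0) ^+ 2.
Proof.
move=> k0 tau_gt0 tau0 wF xiF alF minF e c hec.
have enF (a : T -> V) (a0 : V) : a @ F --> a0 ->
    enorm (a t - w t) @[t --> F] --> enorm (a0 - w0).
  move=> aF; apply: continuous_cvg; first exact: enorm_continuous.
  exact: cvgB.
have sqF (f : T -> R) (f0 : R) : f @ F --> f0 ->
    k * f t ^+ 2 @[t --> F] --> k * f0 ^+ 2.
  by move=> fF; apply: cvgMr; exact: (cvgM fF fF).
rewrite -subr_le0.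
(* With competitors within s of e, the error is s plus the increment of the
   square from |e - w0| to |e - w0| + s. *)
apply: (@le0_small_mult _ _ (1 + k * (2 * enorm (e - w0) + 1))) => s /andP[s0 s1].
rewrite lerBlDr.
apply: (@le_trans _ _ (c + s + k * (enorm (e - w0) + s) ^+ 2)); last first.
  have := enorm_ge0 (e - w0); set m := enorm _ => m0.
  have : 0 <= k * (s * (1 - s)) by rewrite !mulr_ge0 ?subr_ge0 ?(ltW s0) ?(ltW s1).
  by rewrite sqrrD; lra.
apply: (@ler_cvg_to _ F _ _ (fun t => al t + k * enorm (xi t - w t) ^+ 2)
   (fun t => c + s + k * (enorm (e - w t) + s) ^+ 2)).
- by apply: cvgD => //; apply/sqF/enF.
- apply: cvgD; first exact: cvg_cst.
  apply: sqF; apply: cvgD; last exact: cvg_cst.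
  by apply: (enF (fun=> e)); apply: cvg_cst.
have near_e : nbhs e [set e' | enorm (e' - e) < s].
  by apply/nbhs_enormP; exists s.
have rec := epi_limit_recovery gh FF tau_gt0 tau0 hec near_e s0.
apply: filterS2 minF rec => t mint [e' /= e'e] /mint H.
apply: le_trans H _; rewrite lerD2l ler_wpM2l//.
rewrite ler_sqr ?nnegrE ?addr_ge0 ?enorm_ge0 ?(ltW s0)//.
by have := enorm_triangle e e' (w t); lra.
Qed.

(** Substitute u = xb + tau e in the proximal objective at
    xb + gamma vb + tau w: after completing the square and dropping constants,
    what remains is tau^2 / 2 times the proximal objective at w of the
    second-order difference quotient of g. *)
Lemma prox_quot_min (tau : R) (w : V) : 0 < tau ->
  let xi := tau^-1 *: (prox gamma g (xb + gamma *: vb + tau *: w) - xb) in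
  exists2 al, (diff_quot2 g tau xb vb xi <= al%:E)%E &
    forall e c, (diff_quot2 g tau xb vb e <= c%:E)%E ->
      al + gamma^-1 * enorm (xi - w) ^+ 2 <= c + gamma^-1 * enorm (e - w) ^+ 2.
Proof.
move=> tau0 xi; set z := _ + tau *: w in xi *.
have s0 : 0 < tau ^+ 2 / 2 by rewrite divr_gt0// exprn_gt0.
have pE : xb + tau *: xi = prox gamma g z.
  by rewrite /xi scalerA divff ?gt_eqF// scale1r addrC subrK.
have pfin := prox_fin z; have pmin := prox_min z.
have xfin := xb_sub.1.
set r := fine (g (prox gamma g z)); set r0 := fine (g xb).
exists ((r - r0 - tau * dot vb xi) / (tau ^+ 2 / 2)).
  rewrite (diff_quot2_le g_proper gh)// pE -(fineK pfin) lee_fin -/r -/r0.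
  by rewrite (mulrC (tau ^+ 2 / 2)) divfK ?gt_eqF//; lra.
move=> e c; rewrite (diff_quot2_le g_proper gh)// -/r0 => ge.
have := le_trans (pmin (xb + tau *: e)) (leeD ge (lexx _)).
rewrite -pE -[X in (X + _ <= _)%E]fineK ?pE// -/r -!EFinD lee_fin -pE.
have zE a : xb + tau *: a - z = tau *: (a - w) - gamma *: vb.
  by rewrite /z; apply/rowP => i; rewrite !mxE; ring.
have qE a : (2 * gamma)^-1 * enorm (xb + tau *: a - z) ^+ 2 =
    tau ^+ 2 / 2 * (gamma^-1 * enorm (a - w) ^+ 2) - tau * dot vb a
      + (tau * dot vb w + gamma / 2 * dot vb vb).
  rewrite zE !sqr_enorm (dotBl (tau *: _)).
  rewrite !(dotBr _ _ (tau *: _)) !(dotBr _ _ (gamma *: _)).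
  rewrite !dotZl !dotZr (dotC (a - w) vb) [dot vb (a - w)]dotBr.
  by field; rewrite gt_eqF.
rewrite !qE => H.
rewrite -(ler_pM2l s0) !mulrDr mulrCA divff ?gt_eqF// mulr1; lra.
Qed.


(** If w |-> w D failed to be the derivative, there would be directions
    u_i tending to 0 along which the error exceeds e |u_i|. Normalize them to
    unit vectors w_i and pass to the limit in the proximal problems solved by
    the quotients xi_i: the limit xi0 solves the limit problem at w0, so
    xi0 = w0 D, contradicting the error bound.  The last conclusion is
    stationarity tested against the minimizer itself. *)
Lemma prox_differentiable : generalized_quadratic h ->
  exists D : 'M[R]_n,
  [/\ differentiable (prox gamma g) (xb + gamma *: vb),
      forall u, 'd (prox gamma g) (xb + gamma *: vb) u = u *m D
    & forall u, h (u *m D) = (gamma^-1 * dot (u - u *m D) (u *m D))%:E].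
Proof.
move=> [M [S hE]]; set z := xb + gamma *: vb.
have k0 : 0 < gamma^-1 by rewrite invr_gt0.
have q_ge0 w : w \in S -> 0 <= dot w (w *m M^T).
  by move=> wS; apply: (epi_limit_ge0 g_proper gh (w := w)); rewrite hE wS.
(* Half the Hessian of the limit objective; it is definite on S because the
   epi-limit of nonnegative quotients is nonnegative. *)
pose N := 2^-1 *: (M + M^T) + (gamma^-1)%:M.
have NE a : dot (a *m N) a = dot a (a *m M^T) + gamma^-1 * dot a a.
  rewrite mulmxDr mul_mx_scalar -scalemxAr mulmxDr dot_adj !dotE.
  by rewrite (dotC (a *m M^T)) dot_adj; lra.
have N_inj a : a \in S -> dot (a *m N) a = 0 -> a = 0.
  move=> aS; rewrite NE => a0; apply/dot_eq0/eqP.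
  have := q_ge0 a aS; have := dot_ge0 a; rewrite le0r => /orP[//|a1].
  by have := mulr_gt0 k0 a1; lra.
have [D DP] := galerkin_matrix gamma^-1 N_inj.
exists D.
have PE : prox gamma g z = xb by exact:
  (prox_resolvent gamma_gt0 g_proper g_lsc g_convex xb_sub xb_sub).
suff /enorm_diff[dP dPE] : forall e : R, 0 < e -> exists2 r, 0 < r &
    forall u, enorm u < r ->
    enorm (prox gamma g (z + u) - prox gamma g z - u *m D) <= e * enorm u.
  split=> // u; have [uS uE] := DP u; rewrite hE uS; congr EFin.
  by have := uE _ uS; rewrite NE dotBl; lra.
move=> e e0; apply: contrapT => noR.
have bad (i : nat) : exists u, enorm u < i.+1%:R^-1 /\
    e * enorm u < enorm (prox gamma g (z + u) - xb - u *m D).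
  apply: contrapT => noU; apply: noR; exists i.+1%:R^-1 => // u ui.
  by rewrite PE leNgt; apply/negP => ue; apply: noU; exists u.
have [u uP] := choice bad.
pose tau i := enorm (u i); pose w i := (tau i)^-1 *: u i.
have tau_gt0 i : 0 < tau i.
  rewrite lt_def enorm_ge0 andbT; apply/eqP => /enorm_eq0 u0.
  have := (uP i).2; rewrite u0 addr0 PE mul0mx subrr subr0 enorm0.
  by rewrite mulr0 ltxx.
have uE i : u i = tau i *: w i by rewrite scalerA divff ?gt_eqF// scale1r.
have w1 i : enorm (w i) = 1.
  by rewrite enormZ ger0_norm ?invr_ge0 ?enorm_ge0// mulVf ?gt_eqF.
pose xi i := (tau i)^-1 *: (prox gamma g (z + tau i *: w i) - xb).
have xi_le1 i : enorm (xi i) <= 1.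
  rewrite enormZ ger0_norm ?invr_ge0 ?enorm_ge0// ler_pdivrMl// mulr1.
  rewrite -uE -[in leLHS]PE.
  rewrite (le_trans (prox_nonexpansive gamma_gt0 g_proper g_lsc g_convex xb_sub _ _))//.
  by rewrite [z + _ - z]addrAC subrr add0r.
have alex i : exists a : R, (diff_quot2 g (tau i) xb vb (xi i) <= a%:E)%E /\
    forall e c, (diff_quot2 g (tau i) xb vb e <= c%:E)%E ->
      a + gamma^-1 * enorm (xi i - w i) ^+ 2 <=
        c + gamma^-1 * enorm (e - w i) ^+ 2.
  by have [a aP amin] := prox_quot_min (w i) (tau_gt0 i); exists a.
have [al alP] := choice alex.
(* The upper bound compares xi with the competitor 0, whose quotient is 0. *)
have al_itv i : al i \in `[0, gamma^-1].
  rewrite in_itv/=; apply/andP; split.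
    exact: (diff_quot2_ge0 g_proper gh (tau_gt0 i) (alP i).1).
  have := (alP i).2 0 0; rewrite (diff_quot2_le g_proper gh)//.
  rewrite scaler0 addr0 dot0r !mulr0 !addr0 fineK ?xb_sub.1// lexx => /(_ isT).
  rewrite !add0r enormN w1 expr1n mulr1; apply: le_trans.
  by rewrite lerDl mulr_ge0 ?sqr_ge0// ltW.
have [U [UU sU]] := @ultraFilterLemma _ (\oo : set_system nat) _.
have w_bd : \forall i \near U, [set v : V | enorm v <= 1] (w i).
  by apply: nearW => i /=; rewrite w1.
have xi_bd : \forall i \near U, [set v : V | enorm v <= 1] (xi i).
  by apply: nearW => i /=; apply: xi_le1.
have al_bd : \forall i \near U, [set` `[0, gamma^-1]] (al i).
  by apply: nearW => i /=; apply: al_itv.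
have [w0 _ wU] := ultra_cvg UU (@enorm_ball_compact R n 1) w_bd.
have [xi0 _ xiU] := ultra_cvg UU (@enorm_ball_compact R n 1) xi_bd.
have [al0 _ alU] := ultra_cvg UU (@segment_compact R 0 gamma^-1) al_bd.
have tauU : tau @ U --> 0.
  apply: (@squeeze_cvgr _ _ _ _ (fun=> 0) (fun i => i.+1%:R^-1)).
  - by apply: nearW => i; rewrite enorm_ge0 ltW// (uP i).1.
  - exact: cvg_cst.
  - by move=> A /cvg_harmonic HA; apply: sU.
have tau_near : \forall i \near U, 0 < tau i by apply: nearW.
have h_xi0 : (h xi0 <= al0%:E)%E.
  apply: (epi_limit_lower gh _ tau_near tauU xiU alU).
  by apply: nearW => i; apply: (alP i).1.
have xi0_min := epi_limit_minimizer _ (ltW k0) tau_near tauU wU xiU alU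
  (nearW _ (fun i => (alP i).2)).
have xi0S : xi0 \in S by move: h_xi0; rewrite hE; case: ifP.
have qxi0 : dot xi0 (xi0 *m M^T) <= al0.
  by move: h_xi0; rewrite hE xi0S lee_fin.
have xi0_st e' : e' \in S -> dot (xi0 *m N) e' = gamma^-1 * dot w0 e'.
  apply: quadratic_stationary => // a aS.
  have ha : (h a <= (dot a (a *m M^T))%:E)%E by rewrite hE aS.
  by apply: le_trans (xi0_min _ _ _ _ ha); rewrite lerD2r.
have xi0E : xi0 = w0 *m D.
  have [wS wE] := DP w0.
  apply/eqP; rewrite -subr_eq0; apply/eqP/N_inj; first by rewrite rpredB.
  by rewrite mulmxBl dotBl xi0_st ?rpredB// wE ?rpredB// subrr.
have [C C0 DC] := mulmx_enorm_bound D.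
have : e <= 0 + C * 0.
  apply: (@ler_cvg_to _ U _ _ (fun=> e)
    (fun i => enorm (xi i - xi0) + C * enorm (w i - w0))).
  - exact: cvg_cst.
  - by apply: cvgD; [exact: enorm_cvg0|apply: cvgMr; exact: enorm_cvg0].
  apply: nearW => i; have := ltW (uP i).2.
  have -> : prox gamma g (z + u i) - xb - u i *m D = tau i *: (xi i - w i *m D).
    rewrite /xi scalerBr scalerA divff ?gt_eqF// scale1r -uE.
    by rewrite [in u i *m D]uE scalemxAl.
  rewrite enormZ ger0_norm ?enorm_ge0// (mulrC e).
  rewrite (ler_pM2l (tau_gt0 i)) => /le_trans; apply.
  apply: le_trans (enorm_triangle xi0 _ _) _; rewrite lerD2l xi0E -mulmxBl.
  by rewrite (le_trans (DC _))// enormBC.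
by rewrite mulr0 addr0 leNgt e0.
Qed.

End ProxDerivative.

(** * The Dennis-More argument *)

Lemma quot_cvg0P {R : realType} (a b : nat -> R) :
  (forall k, 0 <= a k) -> (forall k, 0 <= b k) ->
  quot_cvg0 a b <-> (\forall k \near \oo, b k != 0) /\
    forall e : R, 0 < e -> \forall k \near \oo, a k <= e * b k.
Proof.
move=> a0 b0; split=> -[bn0 H]; split=> //.
  move=> e e0; move/cvgrPdist_le: H => /(_ e e0); apply: filterS2 bn0 => k bk.
  have bgt0 : 0 < b k by rewrite lt_def bk b0.
  by rewrite sub0r normrN ger0_norm ?divr_ge0// ler_pdivrMr.
apply/cvgrPdist_le => e e0; apply: filterS2 bn0 (H e e0) => k bk.
have bgt0 : 0 < b k by rewrite lt_def bk b0.
by rewrite sub0r normrN ger0_norm ?divr_ge0// ler_pdivrMr.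
Qed.

(** With A = z + d - zb, the vector A J is the Dennis-More residual
    F z + d J minus the linearization error of F at zb, hence
    o(|d| + |z - zb|); since |d| <= |A| + |z - zb|, the term in |A| is
    absorbed on the left.  If z = zb, then A = d must vanish, so the
    denominators are eventually nonzero. *)
Lemma dennis_more_step {R : realType} {n : nat} (F : 'rV[R]_n -> 'rV[R]_n)
    (zb : 'rV[R]_n) (z d : nat -> 'rV[R]_n) :
  differentiable F zb -> F zb = 0 -> jacobian F zb \in unitmx ->
  z @ \oo --> zb ->
  quot_cvg0 (fun k => enorm (F (z k) + d k *m jacobian F zb))
            (fun k => enorm (d k)) ->
  quot_cvg0 (fun k => enorm (z k + d k - zb)) (fun k => enorm (z k - zb)).
Proof.
move=> dF F0 Ju zcvg /quot_cvg0P[||dn0 DM]; try by move=> k; apply: enorm_ge0.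
have [C C0 JC] := mulmx_enorm_bound (invmx (jacobian F zb)).
have small e : 0 < e -> \forall k \near \oo,
    enorm (z k + d k - zb) <= e * enorm (z k - zb).
  (* e1 <= 1 is what allows |A| to be absorbed. *)
  move=> e0; pose e1 := Num.min e 1.
  have e10 : 0 < e1 by rewrite lt_min e0 ltr01.
  have e1e : e1 <= e by rewrite ge_min lexx.
  have e11 : e1 <= 1 by rewrite ge_min lexx orbT.
  have dl0 : 0 < e1 / (4 * C) by rewrite divr_gt0// mulr_gt0.
  have [r r0 Fr] := diff_enorm dF dl0.
  have zr : \forall k \near \oo, enorm (z k - zb) < r.
    exact: (cvgr_lt _ (enorm_cvg0 _ zcvg)).
  apply: filterS2 zr (DM _ dl0) => k /Fr; rewrite subrKC F0 subr0.
  set A := enorm (F _ - _) => AE BE; set a := enorm _; set b := enorm _.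
  set B := enorm (_ + _) in BE.
  have dE : enorm (d k) <= a + b.
    apply: le_trans (enormB (z k + d k - zb) (z k - zb)); rewrite le_eqVlt.
    apply/orP; left; apply/eqP; congr enorm.
    by apply/rowP => i; rewrite !mxE; ring.
  have aE : a <= C * (A + B).
    have -> : a = enorm ((z k + d k - zb) *m jacobian F zb
        *m invmx (jacobian F zb)) by rewrite mulmxK.
    apply: le_trans (JC _) _; rewrite ler_pM2l//.
    rewrite (addrC A).
    have -> : (z k + d k - zb) *m jacobian F zb =
        (F (z k) + d k *m jacobian F zb) - (F (z k) - 'd F zb (z k - zb)).
      rewrite (addrAC (z k)) mulmxDl [X in X + _]mul_rV_lin1.
      by apply/rowP => i; rewrite !mxE; ring.
    exact: enormB.
  have : C * (A + B) <= e1 / 4 * (a + 2 * b).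
    have -> : e1 / 4 = C * (e1 / (4 * C)) by field; rewrite gt_eqF.
    rewrite -mulrA ler_pM2l//.
    have : B <= e1 / (4 * C) * (a + b) by rewrite (le_trans BE)// ler_pM2l.
    by move: AE; rewrite -/b; lra.
  have a0 : 0 <= a := enorm_ge0 _; have b0 : 0 <= b := enorm_ge0 _.
  move=> H; have := le_trans aE H.
  have : e1 * a <= a by rewrite ler_piMl.
  have : e1 * b <= e * b by rewrite ler_wpM2r.
  by have : 0 <= e1 * b by [rewrite mulr_ge0// ltW]; lra.
apply/quot_cvg0P; try by move=> k; apply: enorm_ge0.
split=> //; apply: filterS2 dn0 (small 1 ltr01) => k dk; rewrite mul1r => H.
apply: contraNN dk => /eqP/enorm_eq0 zk.
move: H; rewrite addrAC zk add0r enorm0 => H.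
by rewrite eq_le H enorm_ge0.
Qed.

(** * Second-order growth and regularity of the normal residual *)

Lemma is_diff_residual {R : realType} (V : normedModType R) (G P dG dP : V -> V)
    (z : V) (k : R) :
  is_diff z P dP -> is_diff (P z) G dG ->
  is_diff z (fun y => G (P y) + k *: (y - P y))
    (fun u => dG (dP u) + k *: (u - dP u)).
Proof.
move=> hP hG.
exact: (is_diffD (is_diff_comp hP hG) (is_diffZ k (is_diffB (is_diff_id z) hP))).
Qed.

Section SecondOrder.
Context {R : realType} {n : nat}.
Notation V := 'rV[R]_n.
Variables (f : V -> R) (g : V -> \bar R) (gamma : R) (xb : V) (h : V -> \bar R).
Hypotheses (f_diff : forall y, differentiable f y)
  (gf_diff : differentiable (grad f) xb)
  (gamma_gt0 : 0 < gamma) (g_proper : proper_fun g)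
  (g_lsc : lower_semicontinuous g) (g_convex : convex_fun g)
  (gh : strict_epi_deriv2 g xb (- grad f xb) h).

Let xb_sub : subdiff g xb (- grad f xb). Proof. by case: gh. Qed.

(** A real upper bound s stands in for g y, which may be infinite. *)
Lemma strong_local_minE : strong_local_min (phi f g) xb ->
  exists2 mu : R, 0 < mu & exists2 r : R, 0 < r &
    forall y s, enorm (y - xb) < r -> (g y <= s%:E)%E ->
      f xb + fine (g xb) + mu / 2 * enorm (y - xb) ^+ 2 <= f y + s.
Proof.
move=> [mu mu0 /nbhs_enormP[r r0 rP]]; exists mu => //; exists r => // y s yr ys.
have := le_trans (rP y yr) (leeD (lexx _) ys).
by rewrite /phi -(fineK xb_sub.1) -!EFinD lee_fin.
Qed.

(** Evaluate strong minimality at xb + t u, with u a recovery point for w: the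
    first-order terms of f and g cancel, and dividing by t^2 / 2 leaves the
    claim up to errors that vanish with e. *)
Lemma second_order_growth : strong_local_min (phi f g) xb ->
  exists2 mu : R, 0 < mu & forall w c, (h w <= c%:E)%E ->
    mu * enorm w ^+ 2 <= dot ('d (grad f) xb w) w + c.
Proof.
move=> /strong_local_minE[mu mu0 [r r0 rP]]; exists mu => // w c hwc.
pose psi u := mu * enorm u ^+ 2 - dot ('d (grad f) xb u) u.
have psi_cvg T (F : set_system T) (FF : Filter F) (a : T -> V) a0 :
    a @ F --> a0 -> psi (a t) @[t --> F] --> psi a0.
  move=> aF; apply: cvgB.
    apply: cvgMr; rewrite sqr_enorm; under eq_fun do rewrite sqr_enorm.
    exact: dot_cvg.
  apply: dot_cvg => //; apply: continuous_cvg => //.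
rewrite -lerBlDl -/(psi w) -subr_le0; pose m := enorm w + 1.
have m0 : 0 < m by rewrite ltr_wpDl// enorm_ge0.
apply: (@le0_small_mult _ _ (2 + m ^+ 2)) => e /andP[e0 _].
have [r' r'0 taylor] := taylor2_upper f_diff gf_diff e0.
pose A := [set u : V | psi w - e < psi u] `&` [set u | enorm u < m].
have nA : nbhs w A.
  apply: filterI; last first.
    by apply: (cvgr_lt _ (@enorm_continuous R n w)); rewrite ltrDl.
  apply: (cvgr_gt _ (psi_cvg _ _ (nbhs_filter w) id w cvg_id)).
  by rewrite gtrBl.
have near0 : \forall t \near (0 : R)^'+, 0 < t by exact: nbhs_right_gt.
have cvg0 : id @ (0 : R)^'+ --> (0 : R) by exact: cvg_within.
have lt_r : \forall t \near (0 : R)^'+, t < Num.min r r' / m.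
  by apply: nbhs_right_lt; rewrite divr_gt0// lt_min r0.
have [t [[tr t0] [u [upsi um]]]] := filter_ex (filterI (filterI lt_r near0)
  (epi_limit_recovery gh _ near0 cvg0 hwc nA e0)).
rewrite (diff_quot2_le g_proper gh)// => gu.
have tu : enorm (t *: u) < Num.min r r'.
  rewrite enormZ gtr0_norm// (le_lt_trans (ler_wpM2l (ltW t0) (ltW um)))//.
  by rewrite -ltr_pdivlMr.
rewrite lt_min in tu; have /andP[tur tur'] := tu.
have := rP (xb + t *: u) _ _ gu; rewrite [xb + _ - xb]addrAC subrr add0r.
move=> /(_ tur); have := taylor _ tur'.
rewrite linearZ/= !enormZ gtr0_norm// !dotZl !dotZr dotNl => H1 H2.
have : t ^+ 2 / 2 * (mu * enorm u ^+ 2) <=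
  t ^+ 2 / 2 * (dot ('d (grad f) xb u) u + e * enorm u ^+ 2 + (c + e)) by lra.
rewrite ler_pM2l; last by rewrite divr_gt0// exprn_gt0.
have : e * enorm u ^+ 2 <= e * m ^+ 2.
  by rewrite ler_pM2l// ler_sqr ?nnegrE ?enorm_ge0 ?(ltW m0) ?(ltW um).
move: upsi; rewrite /psi /=; lra.
Qed.

(** For u in the kernel of the Jacobian and w = u D, the growth inequality at w
    bounds mu |w|^2 by the inner product of w with the derivative of the
    residual at u, which is 0. *)
Lemma Rnor_regular : generalized_quadratic h -> strong_local_min (phi f g) xb ->
  let zb := xb - gamma *: grad f xb in
  differentiable (Rnor f g gamma) zb /\ jacobian (Rnor f g gamma) zb \in unitmx.
Proof.
move=> hq xmin zb; have zbE : zb = xb + gamma *: (- grad f xb).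
  by rewrite scalerN.
have [D [dP PE hD]] :=
  prox_differentiable gamma_gt0 g_proper g_lsc g_convex gh hq.
have PzE : prox gamma g zb = xb.
  by rewrite zbE; exact:
    (prox_resolvent gamma_gt0 g_proper g_lsc g_convex xb_sub xb_sub).
rewrite -zbE in dP PE.
have isP : is_diff zb (prox gamma g) (fun u => u *m D).
  by apply: DiffDef => //; apply/funext.
have isG : is_diff (prox gamma g zb) (grad f) ('d (grad f) xb).
  by rewrite PzE; apply/differentiableP.
have isR := is_diff_residual gamma^-1 isP isG.
have dR : differentiable (Rnor f g gamma) zb.
  exact: (@ex_diff _ _ _ _ _ _ _ isR).
have dRE u : 'd (Rnor f g gamma) zb u =
    'd (grad f) xb (u *m D) + gamma^-1 *: (u - u *m D).
  exact: (congr1 (fun F => F u) (@diff_val _ _ _ _ _ _ _ isR)).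
split=> //; rewrite -row_free_unit; apply: inj_row_free => u.
rewrite /jacobian mul_rV_lin1 dRE => u0.
have [mu mu0 growth] := second_order_growth xmin.
have hDu : (h (u *m D) <= (gamma^-1 * dot (u - u *m D) (u *m D))%:E)%E.
  by rewrite hD.
have := growth _ _ hDu; rewrite -dotZl -dotDl u0 dot0l pmulr_rle0// => uD0.
have /enorm_eq0 uD : enorm (u *m D) = 0.
  by apply/eqP; rewrite -sqrf_eq0 eq_le uD0 sqr_ge0.
move/eqP: u0; rewrite uD linear0 add0r subr0 scaler_eq0.
by rewrite invr_eq0 gt_eqF//= => /eqP.
Qed.

(** With p = prox z, the descent lemma contributes <grad f xb, p - xb> and the
    subgradient (z - p) / gamma of g at p contributes its product with p - xb;
    the sum of these two vectors is (z - zb - (p - xb)) / gamma, of the same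
    order as z - zb. *)
Lemma phi_prox_upper (L : R) (z : V) : 0 < L -> gradient_lipschitz L f ->
  f (prox gamma g z) + fine (g (prox gamma g z)) <= f xb + fine (g xb) +
    (gamma^-1 + L / 2) * enorm (z - (xb - gamma *: grad f xb)) ^+ 2.
Proof.
move=> L0 fL; set zb := xb - _; set p := prox gamma g z.
have zbE : zb = xb + gamma *: (- grad f xb) by rewrite scalerN.
have PzE : prox gamma g zb = xb.
  by rewrite zbE; exact:
    (prox_resolvent gamma_gt0 g_proper g_lsc g_convex xb_sub xb_sub).
have [pfin psub] := prox_subdiff gamma_gt0 g_proper g_lsc g_convex xb_sub z.
rewrite -/p in pfin psub.
have := psub xb; rewrite -(fineK pfin) -[X in (_ <= X)%E](fineK xb_sub.1).
rewrite -EFinD lee_fin /= => gp.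
have := descent_lemma f_diff xb (p - xb) fL; rewrite subrKC => fp.
have pz : enorm (p - xb) <= enorm (z - zb).
  rewrite -[xb in leLHS]PzE.
  exact: (prox_nonexpansive gamma_gt0 g_proper g_lsc g_convex xb_sub).
have vE : gamma^-1 *: (z - p) + grad f xb = gamma^-1 *: (z - zb - (p - xb)).
  rewrite -[grad f xb in LHS]scale1r -(mulVf (lt0r_neq0 gamma_gt0)) -scalerA.
  rewrite -scalerDr; congr (_ *: _); rewrite /zb.
  by apply/rowP => i; rewrite !mxE; ring.
have : dot (gamma^-1 *: (z - p) + grad f xb) (p - xb) <=
    gamma^-1 * enorm (z - zb) ^+ 2.
  rewrite vE dotZl ler_pM2l ?invr_gt0// dotBl lerBlDr.
  rewrite (le_trans (dot_le_enorm _ _))// expr2 -[leLHS]addr0 lerD ?dot_ge0//.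
  by rewrite ler_wpM2l ?enorm_ge0.
have : L / 2 * enorm (p - xb) ^+ 2 <= L / 2 * enorm (z - zb) ^+ 2.
  by rewrite ler_pM2l ?divr_gt0// ler_sqr ?nnegrE ?enorm_ge0.
move: gp; rewrite -(opprB p xb) dotNr dotDl; lra.
Qed.

(** The descent lemma bounds f and the subgradient (y - t) / gamma - grad f y
    of g at the new point t bounds g; the gradient terms cancel. *)
Lemma forward_backward_descent (L : R) (y : V) :
  gradient_lipschitz L f -> g y \is a fin_num ->
  f (fb_map f g gamma y) + fine (g (fb_map f g gamma y)) +
    (gamma^-1 - L / 2) * enorm (y - fb_map f g gamma y) ^+ 2 <= f y + fine (g y).
Proof.
move=> fL yfin; set t := fb_map f g gamma y.
have [tfin tsub] := prox_subdiff gamma_gt0 g_proper g_lsc g_convex xb_sub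
  (y - gamma *: grad f y).
rewrite -/(fb_map f g gamma y) -/t in tfin tsub.
have := tsub y; rewrite -(fineK tfin) -[X in (_ <= X)%E](fineK yfin).
rewrite -EFinD lee_fin /=.
rewrite addrAC scalerBr scalerA mulVf ?gt_eqF// scale1r.
have := descent_lemma f_diff y (t - y) fL; rewrite subrKC.
rewrite dotBl dotZl -sqr_enorm -(opprB y t) enormN dotNr; lra.
Qed.

End SecondOrder.

(** * Superlinear convergence *)

Theorem theorem13 (R : realType) (n : nat)
    (f : 'rV[R]_n -> R) (g : 'rV[R]_n -> \bar R) (Lf gamma beta sigma : R)
    (x xhat xbar d : nat -> 'rV[R]_n) (tau : nat -> R) (xstar : 'rV[R]_n)
    (f_diff : forall y, differentiable f y)
    (Lf_gt0 : 0 < Lf)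
    (f_lip : gradient_lipschitz Lf f)
    (g_proper : proper_fun g)
    (g_lsc : lower_semicontinuous g)
    (g_convex : convex_fun g)
    (argmin_phi : argmin (phi f g) !=set0)
    (gamma_itv : 0 < gamma < Lf^-1)
    (beta_itv : 0 < beta < 1)
    (sigma_itv : 0 < sigma < gamma * ((2 - gamma * Lf) / 2))
    (iterates : panoc_lite f g gamma beta sigma x xhat xbar d tau)
    (xstar_min : strong_local_min (phi f g) xstar)
    (f_C2 : strictly_C2_around f xstar)
    (g_epi : exists2 h : 'rV[R]_n -> \bar R,
       strict_epi_deriv2 g xstar (- grad f xstar) h & generalized_quadratic h)
    (xhat_cvg : xhat k @[k --> \oo] --> xstar) :
  let xbarstar := xstar - gamma *: grad f xstar in
  (* row-vector convention: J F(z) d is written d *m jacobian F z *)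
  quot_cvg0
    (fun k => enorm (Rnor f g gamma (xbar k)
                     + d k *m jacobian (Rnor f g gamma) xbarstar))
    (fun k => enorm (d k)) ->
  [/\ quot_cvg0 (fun k => enorm (xbar k + d k - xbarstar))
                (fun k => enorm (xbar k - xbarstar)),
      \forall k \near \oo, tau k = 1
    & quot_cvg0 (fun k => enorm (xhat k.+1 - xstar))
                (fun k => enorm (xhat k - xstar))].
Proof.
move=> zb dm; case: g_epi => h gh hq.
have /andP[gamma0 gammaL] := gamma_itv; have /andP[beta0 beta1] := beta_itv.
have /andP[sigma0 sigmaP] := sigma_itv.
have xs_sub : subdiff g xstar (- grad f xstar) by case: gh.
have gf_diff : differentiable (grad f) xstar by have [] := nbhs_singleton f_C2.
have [dR Ju] :=
  Rnor_regular f_diff gf_diff gamma0 g_proper g_lsc g_convex gh hq xstar_min.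
have PzE : prox gamma g zb = xstar.
  have -> : zb = xstar + gamma *: (- grad f xstar) by rewrite scalerN.
  exact: (prox_resolvent gamma0 g_proper g_lsc g_convex xs_sub xs_sub).
have nonexp := prox_nonexpansive gamma0 g_proper g_lsc g_convex xs_sub.
have R0 : Rnor f g gamma zb = 0.
  rewrite /Rnor PzE /zb addrAC subrr add0r scalerN scalerA mulVf ?gt_eqF//.
  by rewrite scale1r subrr.
case: iterates => xhat0 it.
(* The forward step is K-Lipschitz. *)
pose K := 1 + gamma * Lf.
have K0 : 0 < K by rewrite addr_gt0// mulr_gt0.
have xbarE k : xbar k = xhat k - gamma *: grad f (xhat k) by case: (it k).
have xbarK k : enorm (xbar k - zb) <= K * enorm (xhat k - xstar).
  rewrite xbarE; have -> : xhat k - gamma *: grad f (xhat k) - zb =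
      (xhat k - xstar) - gamma *: (grad f (xhat k) - grad f xstar).
    by apply/rowP => i; rewrite !mxE; ring.
  rewrite (le_trans (enormB _ _))// enormZ gtr0_norm// mulrDl mul1r lerD2l.
  by rewrite -mulrA ler_pM2l.
have xhat_near r : 0 < r -> \forall k \near \oo, enorm (xhat k - xstar) < r.
  by move=> r0; apply: (cvgr_lt _ (enorm_cvg0 _ xhat_cvg)).
have xbar_near r : 0 < r -> \forall k \near \oo, enorm (xbar k - zb) < r.
  move=> r0; have rK : 0 < r / K by rewrite divr_gt0.
  apply: filterS (xhat_near _ rK) => k; rewrite ltr_pdivlMr// mulrC.
  exact: le_lt_trans.
have xbar_cvg : xbar @ \oo --> zb.
  by move=> A /nbhs_enormP[r r0 rA]; apply: filterS (xbar_near r r0) => k /rA.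
have quot1 := dennis_more_step dR R0 Ju xbar_cvg dm.
have /quot_cvg0P[||bn0 small] := quot1; try by move=> k; apply: enorm_ge0.
have xhat_fin k : g (xhat k) \is a fin_num.
  have pf := prox_fin_num gamma0 g_proper g_lsc xs_sub.
  by case: k => [|k]; [rewrite xhat0|case: (it k) => _ _ ->].
have tau1 : \forall k \near \oo, tau k = 1.
  have [mu mu0 [r r0 loc]] := strong_local_minE gh xstar_min.
  pose delta := gamma * ((2 - gamma * Lf) / 2) - sigma.
  have delta0 : 0 < delta by rewrite subr_gt0.
  (* The margin left by the sufficient decrease is at least
     delta / gamma^2 |xhat - T|^2 + mu / 2 |T - xs|^2 with T the
     forward-backward point, and this is at least c |xhat - xs|^2. *)
  pose c := Num.min (mu / 2) (delta / gamma ^+ 2) / 2.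
  have c0 : 0 < c.
    by rewrite divr_gt0// lt_min !divr_gt0// exprn_gt0.
  have c_mu : 2 * c <= mu / 2 by rewrite mulrC divfK// ge_min lexx.
  have c_delta : 2 * c <= delta / gamma ^+ 2.
    by rewrite mulrC divfK// ge_min lexx orbT.
  pose C := gamma^-1 + Lf / 2.
  have C0 : 0 < C by rewrite addr_gt0 ?invr_gt0 ?divr_gt0.
  (* Small enough for C (e K |xhat - xs|)^2, which bounds the excess of phi at
     the unit step, to stay within that margin. *)
  pose e := Num.min 1 (c / (C * K ^+ 2)).
  have e0 : 0 < e by rewrite lt_min ltr01 divr_gt0// mulr_gt0// exprn_gt0.
  have eC : C * (e * K) ^+ 2 <= c.
    have -> : C * (e * K) ^+ 2 = e ^+ 2 * (C * K ^+ 2) by ring.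
    rewrite -ler_pdivlMr ?mulr_gt0 ?exprn_gt0//.
    have e2 : e <= c / (C * K ^+ 2) by rewrite ge_min lexx orbT.
    apply: le_trans e2; rewrite expr2 ler_piMr ?(ltW e0)//.
    by rewrite ge_min lexx.
  apply: filterS2 (small e e0) (xbar_near r r0) => k zk xk.
  case: (it k) => _ _ _ [[i tauE] _] tau_max.
  suff ls : linesearch f g gamma sigma (xhat k) (xbar k) (d k) 1.
    apply/eqP; rewrite eq_le; apply/andP; split.
      by rewrite tauE exprn_ile1// ltW.
    by have := tau_max 0; rewrite expr0; apply.
  rewrite /linesearch scale1r /phi -(fineK (xhat_fin k)).
  have pfin := prox_fin_num gamma0 g_proper g_lsc xs_sub (xbar k + d k).
  rewrite -(fineK pfin) -!EFinD lee_fin.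
  have up := phi_prox_upper f_diff gamma0 g_proper g_lsc g_convex gh
    (xbar k + d k) Lf_gt0 f_lip.
  have fb := forward_backward_descent f_diff gamma0 g_proper g_lsc g_convex gh
    f_lip (xhat_fin k).
  have TE : fb_map f g gamma (xhat k) = prox gamma g (xbar k).
    by rewrite /fb_map -xbarE.
  have Tnear : enorm (fb_map f g gamma (xhat k) - xstar) < r.
    by rewrite TE -[xstar in ltLHS]PzE (le_lt_trans (nonexp _ _)).
  have Tfin : g (fb_map f g gamma (xhat k)) \is a fin_num.
    exact: (prox_fin_num gamma0 g_proper g_lsc xs_sub).
  have low := loc _ (fine (g (fb_map f g gamma (xhat k)))) Tnear.
  rewrite fineK// lexx in low; have {}low := low isT.
  rewrite /Rnat enormZ exprMn gtr0_norm ?invr_gt0//.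
  move: up fb low; rewrite -/zb -/C.
  have := enorm_triangle (fb_map f g gamma (xhat k)) (xhat k) xstar.
  have := xbarK k; move: zk.
  set w := enorm (_ - zb); set b := enorm (_ - zb).
  set X := enorm (xhat k - xstar); set Y := enorm (xhat k - _).
  set Z := enorm (fb_map _ _ _ _ - xstar) => wb bX XYZ up fb low.
  have [X0 Y0 Z0 w0] : [/\ 0 <= X, 0 <= Y, 0 <= Z & 0 <= w].
    by split; apply: enorm_ge0.
  have wX : w <= e * K * X.
    by rewrite (le_trans wb)// -mulrA ler_pM2l.
  have H1 : C * w ^+ 2 <= c * X ^+ 2.
    apply: (@le_trans _ _ (C * (e * K * X) ^+ 2)).
      rewrite ler_pM2l// ler_sqr ?nnegrE// !mulr_ge0// ltW//.
    by rewrite exprMn mulrA ler_wpM2r// sqr_ge0.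
  have H2 : X ^+ 2 <= 2 * (Y ^+ 2 + Z ^+ 2).
    apply: (@le_trans _ _ ((Y + Z) ^+ 2)).
      by rewrite ler_sqr ?nnegrE ?addr_ge0.
    by have := sqr_ge0 (Y - Z); rewrite sqrrB sqrrD; lra.
  have H3 : c * X ^+ 2 <= 2 * c * Y ^+ 2 + 2 * c * Z ^+ 2.
    by have := ler_wpM2l (ltW c0) H2; lra.
  have H4 : 2 * c * Z ^+ 2 <= mu / 2 * Z ^+ 2 by rewrite ler_wpM2r ?sqr_ge0.
  have H5 : 2 * c * Y ^+ 2 <= delta / gamma ^+ 2 * Y ^+ 2.
    by rewrite ler_wpM2r ?sqr_ge0.
  have H6 : (gamma^-1 - Lf / 2) * Y ^+ 2 =
      delta / gamma ^+ 2 * Y ^+ 2 + sigma * (gamma^-1 ^+ 2 * Y ^+ 2).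
    by rewrite /delta; field; rewrite gt_eqF.
  lra.
split=> //; apply/quot_cvg0P; try by move=> k; apply: enorm_ge0.
split.
  apply: filterS bn0 => k; apply: contraNN => /eqP xk.
  have := xbarK k; rewrite xk mulr0 => zk.
  by rewrite eq_le zk enorm_ge0.
move=> e e0; have eK : 0 < e / K by rewrite divr_gt0.
apply: filterS2 tau1 (small _ eK) => k tk zk.
case: (it k) => _ -> -> _ _; rewrite tk scale1r -[xstar in leLHS]PzE.
rewrite (le_trans (nonexp _ _))// (le_trans zk)//.
by rewrite mulrAC ler_pdivrMr// -mulrA ler_pM2l// mulrC.
Qed.
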